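(* Let $E$ be a nonempty pointless frame and let $W$ be the family of all maximal proper round filters on $E$. Then the frame $L_W^\star$ is (isomorphic to) $\beta E$, the compact coreflection (Čech--Stone compactification) of $E$.
   Context: All frames are completely regular. A frame is pointless if it has no maximal elements below $\top$, and nonempty if it has more than one element. A filter $x$ on a frame is proper if $\bot\notin x$ and round if for every $a\in x$ there is $b\in x$ completely below $a$; a maximal proper round filter is one that is maximal under inclusion among proper round filters. $\mathbb{2}=\{\bot,\top\}$ is the two-element frame, $\mathbb{2}^W$ the power, and $\chi_Z\in\mathbb{2}^W$ is the characteristic function of $Z\subseteq W$. For $a\in E$, $W_a=\{w\in W:a\in w\}$. Let $L_W''=\{(a,\chi_Z)\in E\times\mathbb{2}^W:Z\subseteq W_a\text{ and }W_a\setminus Z\text{ is finite}\}$; $L_W^\star$ is the family of all joins in $E\times\mathbb{2}^W$ of elements of $L_W''$, which is a completely regular subframe of $E\times\mathbb{2}^W$. $\beta E$ is the coreflection of $E$ in compact (completely regular) frames. *)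

(* Defs.v *)
From HB Require Import structures.
From mathcomp Require Import all_boot all_order all_algebra.
From mathcomp Require Import boolp classical_sets functions cardinality.

Set Implicit Arguments.
Unset Strict Implicit.
Unset Printing Implicit Defensive.

Import Order.TTheory.
Local Open Scope classical_set_scope.
Local Open Scope order_scope.

HB.mixin Record TBLattice_isFrame d T of Order.TBLattice d T := {
  sup : set T -> T;
  sup_ub : forall (A : set T) (x : T), A x -> x <= sup A;
  sup_le : forall (A : set T) (y : T), (forall x, A x -> x <= y) -> sup A <= y;
  meet_sup : forall (a : T) (A : set T),
    a `&` sup A = sup [set a `&` x | x in A]
}.

#[short(type="frameType")]
HB.structure Definition Frame d :=
  { T of Order.TBLattice d T & TBLattice_isFrame d T }.

Section FrameLemmas.
Context {d : Order.disp_t} {E : frameType d}.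
Implicit Types (x y : E) (A B : set E).

Lemma sup_eq A x :
  (forall y, A y -> y <= x) -> (forall z, (forall y, A y -> y <= z) -> x <= z) ->
  sup A = x.
Proof.
move=> ub lub; apply: le_anti; rewrite sup_le //=; apply: lub => y; exact: sup_ub.
Qed.

Lemma sup1 x : sup [set x] = x.
Proof. by apply: sup_eq => [y ->//|z]; apply. Qed.

Lemma sup0 : sup (set0 : set E) = \bot.
Proof. by apply: sup_eq => // z _; exact: le0x. Qed.

Lemma sup2 x y : sup [set x; y] = x `|` y.
Proof.
apply: sup_eq => [z [->|->]|z h]; rewrite ?leUl ?leUr //.
by rewrite leUx !h //; [right|left].
Qed.

Lemma meet_sup2 A B :
  sup A `&` sup B = sup [set z | exists x y, [/\ A x, B y & z = x `&` y]].
Proof.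
apply/esym/sup_eq => [_ [x [y [Ax By ->]]]|z h].
  by rewrite leI2 ?sup_ub.
rewrite meet_sup; apply: sup_le => _ [y By <-].
rewrite meetC meet_sup; apply: sup_le => _ [x Ax <-].
by apply: h; exists x, y; split=> //; rewrite meetC.
Qed.

End FrameLemmas.

Section BoolFrame.

Definition bool_sup (A : set bool) : bool := `[< A true >].

Let bool_sup_ub (A : set bool) (x : bool) : A x -> x <= bool_sup A.
Proof. by case: x => [/asboolT|_] //; rewrite /bool_sup => ->. Qed.

Let bool_sup_le (A : set bool) (y : bool) :
  (forall x, A x -> x <= y) -> bool_sup A <= y.
Proof. by move=> h; rewrite /bool_sup; case: asboolP => // /h. Qed.

Let bool_meet_sup (a : bool) (A : set bool) :
  a `&` bool_sup A = bool_sup [set a `&` x | x in A].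
Proof.
rewrite /bool_sup; apply/idP/asboolP.
  by case: a => //= /asboolP At; exists true.
by case=> x Ax /andP[/= -> xt]; apply/asboolP; rewrite -xt.
Qed.

HB.instance Definition _ := @TBLattice_isFrame.Build _ bool
  bool_sup bool_sup_ub bool_sup_le bool_meet_sup.

End BoolFrame.

Section PowerFrame.
Context (I : Type) (d : Order.disp_t) (E : frameType d).

Let pow_le0 (f : I -> E) : (fun=> \bot : E) <= f.
Proof. by apply/lefP => i; exact: le0x. Qed.

Let pow_le1 (f : I -> E) : f <= (fun=> \top : E).
Proof. by apply/lefP => i; exact: lex1. Qed.

HB.instance Definition _ := Order.hasBottom.Build _ (I -> E) pow_le0.
HB.instance Definition _ := Order.hasTop.Build _ (I -> E) pow_le1.

Definition pow_sup (A : set (I -> E)) : I -> E :=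
  fun i => sup [set f i | f in A].

Let pow_sup_ub (A : set (I -> E)) f : A f -> f <= pow_sup A.
Proof. by move=> Af; apply/lefP => i; apply: sup_ub; exists f. Qed.

Let pow_sup_le (A : set (I -> E)) g : (forall f, A f -> f <= g) -> pow_sup A <= g.
Proof.
by move=> h; apply/lefP => i; apply: sup_le => _ [f /h/lefP fg <-].
Qed.

Let pow_meet_sup (f : I -> E) (A : set (I -> E)) :
  f `&` pow_sup A = pow_sup [set f `&` g | g in A].
Proof.
apply/funext => i; rewrite meetfE meet_sup; congr sup; apply/seteqP; split.
  by move=> _ [_ [g Ag <-] <-]; exists (f `&` g) => //; exists g.
by move=> _ [_ [g Ag <-] <-]; exists (g i) => //; exists g.
Qed.

HB.instance Definition _ := @TBLattice_isFrame.Build _ (I -> E)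
  pow_sup pow_sup_ub pow_sup_le pow_meet_sup.

End PowerFrame.

Section ProductFrame.
Context (d1 d2 : Order.disp_t) (E : frameType d1) (F : frameType d2).

Definition prod_sup (A : set (E *p F)) : E *p F :=
  (sup [set p.1 | p in A], sup [set p.2 | p in A]).

Let prod_sup_ub (A : set (E *p F)) p : A p -> p <= prod_sup A.
Proof. by move=> Ap; rewrite leEprod !sup_ub //=; exists p. Qed.

Let prod_sup_le (A : set (E *p F)) q : (forall p, A p -> p <= q) -> prod_sup A <= q.
Proof.
move=> h; rewrite leEprod; apply/andP.
by split; apply: sup_le => _ [p /h + <-]; rewrite leEprod => /andP[].
Qed.

Let prod_meet_sup (p : E *p F) (A : set (E *p F)) :
  p `&` prod_sup A = prod_sup [set p `&` q | q in A].
Proof.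
by rewrite meetEprod /= !meet_sup; congr pair; congr sup; apply/seteqP; split;
  (move=> _ [_ [q Aq <-] <-]; first [exists (p `&` q) => //; exists q
                                  | by exists q.1 => //; exists q
                                  | by exists q.2 => //; exists q]).
Qed.

HB.instance Definition _ := @TBLattice_isFrame.Build _ (E *prod[Order.prod_display d1 d2] F)
  prod_sup prod_sup_ub prod_sup_le prod_meet_sup.

End ProductFrame.

Record subframe d (E : frameType d) := Subframe {
  subframe_set : set E;
  subframe_top : subframe_set \top;
  subframe_meet : forall x y,
    subframe_set x -> subframe_set y -> subframe_set (x `&` y);
  subframe_sup : forall A, A `<=` subframe_set -> subframe_set (sup A)
}.

Definition subframe_sort d (E : frameType d) (S : subframe E) : Type :=
  {x : E | x \in subframe_set S}.
Coercion subframe_sort : subframe >-> Sortclass.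

Section SubframeFrame.
Context (d : Order.disp_t) (E : frameType d) (S : subframe E).

HB.instance Definition _ := [isSub of (subframe_sort S) for
  (@proj1_sig E (fun x => x \in subframe_set S) : S -> E)].
HB.instance Definition _ := [Choice of (subframe_sort S) by <:].
HB.instance Definition _ := [SubChoice_isSubPOrder of (subframe_sort S) by <: with d].

Implicit Types x y z : S.

Let subframe_valP x : subframe_set S (\val x).
Proof. exact: set_mem (valP x). Qed.

Definition subframe_elt (a : E) (h : subframe_set S a) : S := Sub a (mem_set h).

Let supE_closed (A : set S) : subframe_set S (sup [set \val x | x in A]).
Proof. by apply: subframe_sup => _ [x _ <-]. Qed.

Let join_closed x y : subframe_set S (\val x `|` \val y).
Proof. by rewrite -sup2; apply: subframe_sup => _ [->|->]. Qed.

Let bot_closed : subframe_set S \bot.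
Proof. by rewrite -sup0; apply: subframe_sup. Qed.

Definition sub_meet x y : S :=
  subframe_elt (subframe_meet (subframe_valP x) (subframe_valP y)).
Definition sub_join x y : S := subframe_elt (join_closed x y).
Definition sub_sup (A : set S) : S := subframe_elt (supE_closed A).

Let sub_lexI x y z : (x <= sub_meet y z) = (x <= y) && (x <= z).
Proof. by rewrite -!Order.le_val lexI. Qed.
Let sub_leUx x y z : (sub_join x y <= z) = (x <= z) && (y <= z).
Proof. by rewrite -!Order.le_val leUx. Qed.
Let sub_le0x x : subframe_elt bot_closed <= x.
Proof. by rewrite -Order.le_val le0x. Qed.
Let sub_lex1 x : x <= subframe_elt (subframe_top S).
Proof. by rewrite -Order.le_val lex1. Qed.

HB.instance Definition _ :=
  Order.POrder_isMeetSemilattice.Build d (subframe_sort S) sub_lexI.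
HB.instance Definition _ :=
  Order.POrder_isJoinSemilattice.Build d (subframe_sort S) sub_leUx.
HB.instance Definition _ := Order.hasBottom.Build d (subframe_sort S) sub_le0x.
HB.instance Definition _ := Order.hasTop.Build d (subframe_sort S) sub_lex1.

Let sub_sup_ub (A : set S) x : A x -> x <= sub_sup A.
Proof. by move=> Ax; rewrite -Order.le_val; apply: sup_ub; exists x. Qed.
Let sub_sup_le (A : set S) y : (forall x, A x -> x <= y) -> sub_sup A <= y.
Proof.
by move=> h; rewrite -Order.le_val; apply: sup_le => _ [x /h + <-]; rewrite -Order.le_val.
Qed.
Let sub_meet_sup x (A : set S) : x `&` sub_sup A = sub_sup [set x `&` y | y in A].
Proof.
apply: val_inj; rewrite /= meet_sup; congr sup; apply/seteqP; split.
  by move=> _ [_ [y Ay <-] <-]; exists (x `&` y) => //; exists y.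
by move=> _ [_ [y Ay <-] <-]; exists (\val y) => //; exists y.
Qed.

HB.instance Definition _ := @TBLattice_isFrame.Build d (subframe_sort S)
  sub_sup sub_sup_ub sub_sup_le sub_meet_sup.

End SubframeFrame.

Section FrameNotions.
Context {d : Order.disp_t}.

Definition pseudocomplement (E : frameType d) (a : E) : E :=
  sup [set c : E | a `&` c = \bot].

Definition rather_below (E : frameType d) (a b : E) : Prop :=
  pseudocomplement a `|` b = \top.

(* Interpolation along a scale indexed by the rationals of [0, 1]; the values of
   c outside [0, 1] are irrelevant. *)
Definition completely_below (E : frameType d) (a b : E) : Prop :=
  exists c : rat -> E, [/\ c 0%R = a, c 1%R = b &
    forall r s : rat, (0 <= r)%R -> (r < s)%R -> (s <= 1)%R ->
      rather_below (c r) (c s)].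

Definition completely_regular (E : frameType d) : Prop :=
  forall a : E, a = sup [set b | completely_below b a].

Definition compact_frame (E : frameType d) : Prop :=
  forall A : set E, sup A = \top ->
    exists B : set E, [/\ B `<=` A, finite_set B & sup B = \top].

Definition pointless (E : frameType d) : Prop :=
  ~ exists m : E, m <> \top /\ forall x : E, m < x -> x = \top.

Definition nonempty_frame (E : frameType d) : Prop :=
  exists x y : E, x <> y.

End FrameNotions.

Definition frame_morphism d1 d2 (E : frameType d1) (F : frameType d2)
    (f : E -> F) : Prop :=
  [/\ f \top = \top, forall x y, f (x `&` y) = f x `&` f y &
      forall A : set E, f (sup A) = sup (f @` A)].

(* eps : B -> E exhibits B as the coreflection of E in compact completely
   regular frames; this determines B up to unique isomorphism over E. *)
Definition compact_coreflection d1 d2 (B : frameType d1) (E : frameType d2)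
    (eps : B -> E) : Prop :=
  [/\ compact_frame B, completely_regular B, frame_morphism eps &
    forall d (K : frameType d), compact_frame K -> completely_regular K ->
    forall f : K -> E, frame_morphism f ->
    exists! g : K -> B, frame_morphism g /\ forall k, eps (g k) = f k].

(* Containing \top amounts to being inhabited; the improper filter is allowed. *)
Record frame_filter d (E : frameType d) := FrameFilter {
  filter_set :> set E;
  filter_top : filter_set \top;
  filter_up : forall a b, filter_set a -> a <= b -> filter_set b;
  filter_meet : forall a b, filter_set a -> filter_set b -> filter_set (a `&` b)
}.

Definition proper_filter d (E : frameType d) (x : frame_filter E) : Prop :=
  ~ filter_set x \bot.

Definition round_filter d (E : frameType d) (x : frame_filter E) : Prop :=
  forall a, filter_set x a -> exists2 b, filter_set x b & completely_below b a.

Definition max_round_filters d (E : frameType d) : set (frame_filter E) :=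
  [set x | [/\ proper_filter x, round_filter x &
    forall y : frame_filter E, proper_filter y -> round_filter y ->
      x `<=` y -> y `<=` x]].

Definition char_fun (T : Type) (Z : set T) : T -> bool := fun t => t \in Z.

Section LWstar.
Context (d : Order.disp_t) (E : frameType d) (W : set (frame_filter E)).

Definition W_at (a : E) : set W := [set w | filter_set (\val w) a].
Arguments W_at : clear implicits.

Definition LW'' : set (E *p (W -> bool)) :=
  [set p | exists (a : E) (Z : set W),
    [/\ p = (a, char_fun Z), Z `<=` W_at a & finite_set (W_at a `\` Z)]].

Definition LWstar_set : set (E *p (W -> bool)) :=
  [set p | exists2 A, A `<=` LW'' & p = sup A].

Let LW''_top : LW'' \top.
Proof.
exists \top, setT; split=> [||].
- by congr pair; apply/funext => w; rewrite /char_fun in_setT.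
- by move=> w _; exact: filter_top.
- by rewrite setDT; exact: finite_set0.
Qed.

Let LW''_meet p q : LW'' p -> LW'' q -> LW'' (p `&` q).
Proof.
move=> [a [Y [-> YW Yfin]]] [b [Z [-> ZW Zfin]]].
exists (a `&` b), (Y `&` Z); split.
- by congr pair; apply/funext => w; rewrite /char_fun in_setI.
- by move=> w [/YW wa /ZW wb]; exact: filter_meet.
apply: (@sub_finite_set _ _ ((W_at a `\` Y) `|` (W_at b `\` Z))).
  move=> w [wab nYZ].
  have wa : W_at a w by apply: filter_up wab _; exact: leIl.
  have wb : W_at b w by apply: filter_up wab _; exact: leIr.
  have [Yw|nYw] := pselect (Y w); last by left.
  by right; split=> // Zw; apply: nYZ.
by rewrite finite_setU.
Qed.

Let LWstar_top : LWstar_set \top.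
Proof. by exists [set \top] => [_ ->|]; [exact: LW''_top|rewrite sup1]. Qed.

Let LWstar_meet p q : LWstar_set p -> LWstar_set q -> LWstar_set (p `&` q).
Proof.
move=> [A AL ->] [B BL ->].
exists [set z | exists x y, [/\ A x, B y & z = x `&` y]]; last exact: meet_sup2.
by move=> _ [x [y [/AL xL /BL yL ->]]]; exact: LW''_meet.
Qed.

Let LWstar_sup (P : set (E *p (W -> bool))) :
  P `<=` LWstar_set -> LWstar_set (sup P).
Proof.
move=> PL; exists [set q | LW'' q /\ exists2 p, P p & q <= p] => [q []//|].
apply: sup_eq => [p Pp|z h].
  have [A AL pA] := PL p Pp; rewrite {1}pA; apply: sup_le => q Aq.
  apply: sup_ub; split; first exact: AL.
  by exists p => //; rewrite pA; exact: sup_ub.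
by apply: sup_le => q [_ [p Pp /le_trans]]; apply; exact: h.
Qed.

Definition LWstar : subframe (E *p (W -> bool)) :=
  Subframe LWstar_top LWstar_meet LWstar_sup.

(* The coreflection map is the restriction of the first projection. *)
Definition LWstar_proj (p : LWstar) : E := (\val p).1.

End LWstar.

(* Main.v *)
Require Import Defs.
From mathcomp Require Import all_boot all_order.
From mathcomp Require Import ssralg ssrnum rat ring lra.
From mathcomp Require Import boolp classical_sets cardinality.

(** Write [W] for the set of maximal proper round filters (the points of the
Stone--Čech compactification of [E]) and [W_a] for those that contain [a].

Every maximal round filter [w] is prime in a weak sense: if [c ≺≺ a], then [w]
contains [a] or the pseudocomplement of [c] ([max_dichotomy]); otherwise [w]
and the elements completely above [c] would generate a larger proper round
filter. Everything else is read off from this dichotomy.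

The first step removes the finite exceptional sets from the description of the
frame. If [E] is pointless, a maximal round filter is nowhere dense in the sense
that the elements disjoint from some member of it join to the top
([max_avoid_dense]): their join would otherwise be a maximal element. The same
holds for finitely many filters, and distinct maximal filters are separated by
disjoint elements, so each generator [(a, W_a \ finite)] is already a join of
elements [prin b := (b, W_b)], and these form a base ([prin_basis]).

The dichotomy says that [W_(¬c)] and [W_a] cover [W] when [c ≺≺ a]. Hence [prin]
preserves the completely-below relation and the frame is completely regular
([LWstar_creg]). For compactness, take a cover without finite subcover. Shrink
its members to elements [c ≺≺ b], with [prin b] below a member of the cover; the
pseudocomplements [¬c] generate a proper round filter, and a maximal round
filter containing it would lie in no member of the cover ([cover_finite]).

Finally, a morphism [f : K -> E] from a compact completely regular frame lifts to
the map sending [k] to the join of [prin (f l)] over [l ≺≺ k]. Meets are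
preserved because [≺≺] is stable under meets, and joins by compactness of [K]
together with the dichotomy ([trace_lift_sup]). The lift is unique because the projection to [E] sends only
bottom to bottom, and such a dense morphism can be cancelled on completely
regular frames ([dense_monic]). *)

Set Implicit Arguments.
Unset Strict Implicit.
Unset Printing Implicit Defensive.

Import Order.TTheory.
Local Open Scope classical_set_scope.
Local Open Scope order_scope.

Local Notation "¬ a" := (pseudocomplement a) (at level 35, right associativity).
Local Notation "a ≺ b" := (rather_below a b) (at level 70, no associativity).
Local Notation "a ≺≺ b" := (completely_below a b) (at level 70, no associativity).

(** * Frames and the rather-below relation *)

Section FrameTheory.
Context {d : Order.disp_t} {E : frameType d}.
Implicit Types (a b c u x y : E) (A B : set E).

Lemma sup_sub A B : A `<=` B -> sup A <= sup B.
Proof. by move=> AB; apply: sup_le => x /AB; exact: sup_ub. Qed.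

Lemma frame_meetUr a b c : a `&` (b `|` c) = (a `&` b) `|` (a `&` c).
Proof.
rewrite -sup2 meet_sup -sup2; congr sup; apply/seteqP; split.
  by move=> _ [_ [->|->] <-]; [left|right].
by move=> _ [->|->]; [exists b => //; left|exists c => //; right].
Qed.

Lemma frame_joinIl a b c : (a `&` b) `|` c = (a `|` c) `&` (b `|` c).
Proof.
rewrite frame_meetUr [(a `|` c) `&` b]meetC frame_meetUr joinIK.
by rewrite -joinA meetUK meetC.
Qed.

Lemma top_le_join a b c e : a `|` b = \top -> a <= c -> b <= e -> c `|` e = \top.
Proof. by move=> ab ac be; apply/eqP; rewrite -le1x -ab leU2. Qed.

Lemma meet_le_bot a b c e : a `&` b = \bot -> c <= a -> e <= b -> c `&` e = \bot.
Proof. by move=> ab ca eb; apply/eqP; rewrite -lex0 -ab leI2. Qed.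

Lemma le_of_complement a b c : a `&` c = \bot -> c `|` b = \top -> a <= b.
Proof.
move=> ac cb; rewrite -[a]meetx1 -cb frame_meetUr ac join0x; exact: leIr.
Qed.

Lemma meet_psc a : a `&` ¬ a = \bot.
Proof.
rewrite /pseudocomplement meet_sup; apply: sup_eq => [_ [c ac <-]|z _].
  by rewrite ac.
exact: le0x.
Qed.

Lemma le_psc a c : a `&` c = \bot -> c <= ¬ a.
Proof. by move=> ac; exact: sup_ub. Qed.

Lemma le_psc2 a : a <= ¬ (¬ a).
Proof. by apply: le_psc; rewrite meetC meet_psc. Qed.

Lemma psc_anti a b : a <= b -> ¬ b <= ¬ a.
Proof. by move=> ab; apply: le_psc; exact: (meet_le_bot (meet_psc b)). Qed.

Lemma rather_belowI a b c : a `&` c = \bot -> c `|` b = \top -> a ≺ b.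
Proof. by move=> /le_psc ca cb; exact: top_le_join cb ca _. Qed.

Lemma rather_below_le a b : a ≺ b -> a <= b.
Proof. by apply: le_of_complement; exact: meet_psc. Qed.

Lemma rather_below_mono a a' b b' : a' <= a -> b <= b' -> a ≺ b -> a' ≺ b'.
Proof. by move=> /psc_anti aa bb ab; exact: top_le_join ab aa bb. Qed.

Lemma rather_below_psc a b : a ≺ b -> ¬ b ≺ ¬ a.
Proof.
by move=> ab; rewrite /rather_below joinC; exact: top_le_join ab _ (le_psc2 b).
Qed.

Lemma rather_below_meet a b a' b' : a ≺ b -> a' ≺ b' -> a `&` a' ≺ b `&` b'.
Proof.
move=> ab ab'; rewrite /rather_below joinC frame_joinIl.
rewrite (_ : b `|` _ = \top) ?meet1x; rewrite joinC.
  by apply: top_le_join ab' _ _ => //; apply: psc_anti; exact: leIr.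
by apply: top_le_join ab _ _ => //; apply: psc_anti; exact: leIl.
Qed.

Lemma join_meets_top (I : eqType) (s : seq I) (f : I -> E) u :
  (forall i, i \in s -> f i `|` u = \top) -> (\meet_(i <- s) f i) `|` u = \top.
Proof.
elim: s => [_|i s IH su]; first by rewrite big_nil join1x.
rewrite big_cons frame_joinIl su ?mem_head // meet1x; apply: IH => j js.
by apply: su; rewrite inE js orbT.
Qed.

End FrameTheory.

(** * The completely-below relation *)

Section CompletelyBelow.
Local Open Scope ring_scope.
Context {d : Order.disp_t} {E : frameType d}.
Implicit Types (a b : E).

(** An affine change of parameter turns any piece of a scale into a scale, so
its values are completely below one another. *)
Lemma scale_below (c : rat -> E) (r s : rat) :
  (forall r s : rat, 0 <= r -> r < s -> s <= 1 -> c r ≺ c s) ->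
  0 <= r -> r < s -> s <= 1 -> c r ≺≺ c s.
Proof.
move=> cP r0 rs s1; exists (fun t => c (r + t * (s - r))); split.
- by rewrite GRing.mul0r GRing.addr0.
- by congr c; ring.
- by move=> t u t0 tu u1; apply: cP; nra.
Qed.

Lemma completely_below_scale a b : a ≺≺ b ->
  exists c : rat -> E, [/\ c 0 = a, c 1 = b &
    forall r s : rat, 0 <= r -> r < s -> s <= 1 -> c r ≺≺ c s].
Proof.
by move=> [c [c0 c1 cP]]; exists c; split=> // r s; exact: scale_below.
Qed.

Lemma completely_below_interp a b : a ≺≺ b -> exists2 m, a ≺≺ m & m ≺≺ b.
Proof.
by move=> /completely_below_scale[c [<- <- cP]]; exists (c 2%:R^-1); apply: cP; lra.
Qed.

Lemma completely_below_rather a b : a ≺≺ b -> a ≺ b.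
Proof. by move=> [c [<- <- cP]]; apply: cP. Qed.

Lemma completely_below_le a b : a ≺≺ b -> (a <= b)%O.
Proof. by move=> /completely_below_rather/rather_below_le. Qed.

(** Since the stages of a scale are themselves completely below one another, [g]
may be assumed to respect only [≺≺], with the weaker conclusion [≺]. *)
Lemma completely_below_map d' (F : frameType d') (g : E -> F) a b :
  (forall x y, x ≺≺ y -> g x ≺ g y) -> a ≺≺ b -> g a ≺≺ g b.
Proof.
move=> gP /completely_below_scale[c [<- <- cP]].
by exists (g \o c); split=> // r s r0 rs s1; apply/gP/cP.
Qed.

Lemma completely_below_psc a b : a ≺≺ b -> ¬ b ≺≺ ¬ a.
Proof.
move=> [c [<- <- cP]]; exists (fun t => ¬ (c (1 - t))); split.
- by rewrite GRing.subr0.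
- by rewrite GRing.subrr.
- by move=> r s r0 rs s1; apply: rather_below_psc; apply: cP; lra.
Qed.

Lemma completely_below_meet a b a' b' :
  a ≺≺ b -> a' ≺≺ b' -> (a `&` a')%O ≺≺ (b `&` b')%O.
Proof.
move=> [c [<- <- cP]] [c' [<- <- cP']]; exists (fun t => c t `&` c' t)%O.
by split=> // r s r0 rs s1; apply: rather_below_meet; [exact: cP|exact: cP'].
Qed.

Lemma completely_below_mono a a' b b' :
  (a' <= a)%O -> (b <= b')%O -> a ≺≺ b -> a' ≺≺ b'.
Proof.
move=> aa bb [c [c0 c1 cP]].
(* lowering the value at 0 and raising the value at 1 leaves a scale *)
exists (fun t => if t == 0 then a' else if t == 1 then b' else c t).
split=> [||r s r0 rs s1]; rewrite ?eqxx //.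
have rc : r != 1 by apply/eqP; lra.
have sc : s != 0 by apply/eqP; lra.
rewrite (negPf rc) (negPf sc).
apply: rather_below_mono (cP r s r0 rs s1).
  by case: eqP => // ->; rewrite c0.
by case: eqP => // ->; rewrite c1.
Qed.

Lemma completely_below_top : (\top : E) ≺≺ (\top : E).
Proof.
exists (fun=> \top)%O; split=> // r s _ _ _; exact: joinx1.
Qed.
End CompletelyBelow.

(** * Frame morphisms *)

Section FrameMorphisms.
Context {d1 d2 : Order.disp_t} {K : frameType d1} {L : frameType d2}.

Section Basic.
Variables (f : K -> L) (f_mor : frame_morphism f).

Lemma morph_bot : f \bot = \bot.
Proof. by case: f_mor => _ _ fS; rewrite -sup0 fS image_set0 sup0. Qed.

Lemma morph_join x y : f (x `|` y) = f x `|` f y.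
Proof.
case: f_mor => _ _ fS; rewrite -sup2 fS -sup2; congr sup; apply/seteqP; split.
  by move=> _ [_ [->|->] <-]; [left|right].
by move=> _ [->|->]; [exists x => //; left|exists y => //; right].
Qed.

Lemma morph_disjoint x y : x `&` y = \bot -> f x `&` f y = \bot.
Proof. by case: f_mor => _ fI _ xy; rewrite -fI xy morph_bot. Qed.

Lemma morph_cover x y : x `|` y = \top -> f x `|` f y = \top.
Proof. by case: f_mor => fT _ _ xy; rewrite -morph_join xy fT. Qed.

Lemma morph_rather_below x y : x ≺ y -> f x ≺ f y.
Proof.
by move=> xy; apply: rather_belowI (morph_cover xy); apply/morph_disjoint/meet_psc.
Qed.

Lemma morph_completely_below x y : x ≺≺ y -> f x ≺≺ f y.
Proof.
by apply: completely_below_map => u v /completely_below_rather/morph_rather_below.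
Qed.

End Basic.
End FrameMorphisms.

(** If [k' ≺≺ k], then [g k'] is disjoint from [h (¬ k')], because this holds after
applying [eps]; as [h (¬ k')] and [h k] cover, [g k' <= h k]. *)
Lemma dense_monic d1 d2 d3 (K : frameType d1) (B : frameType d2) (E : frameType d3)
    (eps : B -> E) (g h : K -> B) :
  completely_regular K -> frame_morphism eps ->
  (forall p, eps p = \bot -> p = \bot) ->
  frame_morphism g -> frame_morphism h ->
  (forall k, eps (g k) = eps (h k)) -> g = h.
Proof.
move=> Kreg epsm dense.
suff le (g' h' : K -> B) : frame_morphism g' -> frame_morphism h' ->
    (forall k, eps (g' k) = eps (h' k)) -> forall k, g' k <= h' k.
  by move=> gm hm gh; apply/funext => k; apply: le_anti; rewrite !le.
move=> gm hm gh k; rewrite [in g' k](Kreg k).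
case: (gm) => _ _ ->; apply: sup_le => _ [k' kk <-].
apply: le_of_complement (morph_cover hm (completely_below_rather kk)).
apply: dense; case: (epsm) => _ -> _; rewrite gh.
by case: (epsm) => _ <- _; rewrite (morph_disjoint hm (meet_psc _)) (morph_bot epsm).
Qed.

(** * Maximal round filters *)

Local Notation "a ∈ w" := (filter_set w a) (at level 70, no associativity).

Section MaxRoundFilters.
Context {d : Order.disp_t} {E : frameType d}.
Implicit Types (a b c u x y : E) (w v : frame_filter E).
Local Notation W := (@max_round_filters d E).

Lemma filter_meets w (I : eqType) (s : seq I) (f : I -> E) :
  (forall i, i \in s -> f i ∈ w) -> \meet_(i <- s) f i ∈ w.
Proof.
elim: s => [_|i s IH sw]; first by rewrite big_nil; exact: filter_top.
rewrite big_cons; apply: filter_meet; first exact/sw/mem_head.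
by apply: IH => j js; apply: sw; rewrite inE js orbT.
Qed.

Lemma filter_disjoint w a b : proper_filter w -> a ∈ w -> a `&` b = \bot -> ~ b ∈ w.
Proof. by move=> wP wa ab wb; apply: wP; rewrite -ab; exact: filter_meet. Qed.

Lemma frame_filter_eq w v : w `<=` v -> v `<=` w -> w = v.
Proof.
move=> wv vw; case: w v wv vw => [w w1 w2 w3] [v v1 v2 v3] /= wv vw.
have e : w = v by apply/seteqP.
by subst v; congr FrameFilter; exact: Prop_irrelevance.
Qed.

(** If [¬ c] is not in [w], every member of [w] meets [c], so [w] and the elements
completely above [c] generate a proper filter. It is round by interpolation, so
it lies in [w] by maximality; and it contains [a]. *)
Lemma max_dichotomy w a c : W w -> c ≺≺ a -> a ∈ w \/ ¬ c ∈ w.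
Proof.
move=> [wP wR wM] ca; have [wc|nwc] := pselect (¬ c ∈ w); first by right.
pose G := [set u | exists z e, [/\ z ∈ w, c ≺≺ e & z `&` e <= u]].
have ctop : c ≺≺ \top by exact: completely_below_mono ca.
have Gtop : G \top by exists \top, \top; split=> //; exact: filter_top.
have Gup (u v : E) : G u -> u <= v -> G v.
  by move=> [z [e [wz ce zeu]]] uv; exists z, e; split=> //; exact: le_trans uv.
have Gmeet (u v : E) : G u -> G v -> G (u `&` v).
  move=> [z [e [wz ce zeu]]] [z' [e' [wz' ce' zeu']]].
  exists (z `&` z'), (e `&` e'); split; first exact: filter_meet.
    by rewrite -[c]meetxx; exact: completely_below_meet.
  by rewrite meetACA leI2.
left; apply: (wM (FrameFilter Gtop Gup Gmeet)).
- move=> [z [e [wz ce]]]; rewrite lex0 => /eqP ze; apply: nwc.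
  apply: (filter_up wz); apply: le_psc; rewrite meetC.
  exact: meet_le_bot ze _ (completely_below_le ce).
- move=> u [z [e [wz ce zeu]]].
  have [z' wz' zz] := wR _ wz; have [e' ce' ee] := completely_below_interp ce.
  exists (z' `&` e'); first by exists z', e'.
  exact: completely_below_mono zeu (completely_below_meet zz ee).
- by move=> z wz; exists z, \top; split=> //; exact: leIl.
- exists \top, a; split=> //; first exact: filter_top.
  exact: leIr.
Qed.

Lemma max_separated w v : W w -> W v -> w <> v -> exists2 b, b ∈ w & ¬ b ∈ v.
Proof.
move=> wW vW wv.
have [a wa nva] : exists2 a, a ∈ w & ~ a ∈ v.
  apply: contra_notP wv => h.
  have wv : w `<=` v by move=> a wa; apply: contrapT => nva; apply: h; exists a.
  apply: frame_filter_eq (wv) _; case: wW => _ _; apply=> //; by case: vW.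
case: (wW) => _ wR _; have [b wb ba] := wR _ wa.
by exists b => //; case: (max_dichotomy vW ba).
Qed.

(** Zorn's lemma, applied to the proper round filters above [v]: both properties
pass to unions of chains. *)
Lemma max_round_extend v : proper_filter v -> round_filter v ->
  exists2 w, W w & v `<=` w.
Proof.
move=> vP vR.
pose above w := [/\ proper_filter w, round_filter w & v `<=` w].
pose T := {w | above w}.
pose t0 : T := exist above v (And3 vP vR (@subset_refl _ v)).
pose R (s t : T) := `[< sval s `<=` sval t >].
have [||A Atot|[w [wP wR vw]] wM] := ZL_preorder t0 (R := R).
- by move=> t; exact/asboolP.
- by move=> r s t /asboolP rs /asboolP st; apply/asboolP; exact: subset_trans st.
- (* adding v itself to the chain makes the union nonempty *)
  pose C : set T := [set s | A s \/ s = t0].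
  have Ctot (s t : T) : C s -> C t -> sval s `<=` sval t \/ sval t `<=` sval s.
    move=> [As|->] [At|->].
    + by have [/asboolP|/asboolP] := Atot s t As At; [left|right].
    + by right; case: (svalP s).
    + by left; case: (svalP t).
    + by left.
  pose U := [set a | exists2 s : T, C s & a ∈ sval s].
  have Utop : U \top by exists t0; [right|exact: filter_top].
  have Uup a b : U a -> a <= b -> U b.
    by move=> [s Cs sa] ab; exists s => //; exact: filter_up ab.
  have Umeet a b : U a -> U b -> U (a `&` b).
    move=> [s Cs sa] [t Ct tb]; have [st|ts] := Ctot s t Cs Ct.
      by exists t => //; apply: filter_meet => //; exact: st.
    by exists s => //; apply: filter_meet => //; exact: ts.
  have UP : above (FrameFilter Utop Uup Umeet).
    split.
    + by move=> [s _]; case: (svalP s).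
    + move=> a [s Cs sa]; have [_ sR _] := svalP s.
      by have [b sb ba] := sR _ sa; exists b => //; exists s.
    + by move=> a va; exists t0 => //; right.
  exists (exist above _ UP) => s As; apply/asboolP => a sa.
  by exists s => //; left.
- exists w => //; split=> // u uP uR wu.
  have uT : above u by split=> //; exact: subset_trans wu.
  exact/asboolP/(wM (exist above u uT))/asboolP.
Qed.

(** An element [x] that is not below the join [m] must belong to [w]: some
[b ≺≺ x] is not below [m], so [¬ b] is not in [w], and the dichotomy applies.
By roundness some [e ≺≺ x] is in [w], and [¬ e <= m] then gives
[m `|` x = \top]. So [m], if it were not the top, would be maximal. *)
Lemma max_avoid_dense w : completely_regular E -> pointless E -> W w ->
  sup [set b | ¬ b ∈ w] = \top.
Proof.
move=> Ereg Epl wW; set m := sup _.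
have mP x : ~ x <= m -> m `|` x = \top.
  move=> xm.
  have [b bx bm] : exists2 b, b ≺≺ x & ~ b <= m.
    apply: contra_notP xm => h; rewrite [x]Ereg; apply: sup_le => b bx.
    by apply: contrapT => bm; apply: h; exists b.
  have [wx|wb] := max_dichotomy wW bx; last by case: bm; exact: sup_ub.
  case: (wW) => _ wR _; have [e we ex] := wR _ wx.
  apply: top_le_join (completely_below_rather ex) _ (lexx x).
  by apply: sup_ub; exact: filter_up we (le_psc2 e).
apply: contrapT => mT; apply: Epl; exists m; split=> // x mx.
rewrite -[RHS](mP x); first by apply/esym/join_idPr/ltW.
by move=> xm; move: (lt_le_trans mx xm); rewrite ltxx.
Qed.

End MaxRoundFilters.

(** * Elements of the frame as pairs *)

Section LWstarTheory.
Context {d : Order.disp_t} {E : frameType d} (W : set (frame_filter E)).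
Local Notation L := (LWstar W).
Implicit Types (a b c : E) (s : seq E) (p q : L) (w : W).

Definition trace p w : bool := (\val p).2 w.

Lemma prin_subproof a : subframe_set L (a, char_fun (@W_at d E W a)).
Proof.
exists [set (a, char_fun (@W_at d E W a))]; last by rewrite sup1.
move=> _ ->; exists a, (@W_at d E W a); split=> //.
by rewrite setDv; exact: finite_set0.
Qed.

(** The generator over [a] with empty exceptional set: [(a, W_a)]. *)
Definition prin a : L := subframe_elt (prin_subproof a).

Lemma proj_prin a : LWstar_proj (prin a) = a.
Proof. by []. Qed.

Lemma trace_prin a w : trace (prin a) w <-> a ∈ \val w.
Proof. by split=> [/set_mem|/mem_set]. Qed.

Lemma le_LWstar p q :
  p <= q <-> LWstar_proj p <= LWstar_proj q /\ (forall w, trace p w -> trace q w).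
Proof.
rewrite -Order.le_val leEprod /trace; split.
  by move=> /andP[pq /lefP h]; split=> // w; move: (h w); case: (_ w); case: (_ w).
move=> [pq h]; apply/andP; split=> //; apply/lefP => w.
by move: (h w); case: (_ w); case: (_ w) => // ->.
Qed.

Lemma trace_le p q w : p <= q -> trace p w -> trace q w.
Proof. by move=> /le_LWstar[_]; apply. Qed.

Lemma eq_LWstar p q :
  LWstar_proj p = LWstar_proj q -> (forall w, trace p w <-> trace q w) -> p = q.
Proof.
by move=> pq h; apply: le_anti; apply/andP; split; apply/le_LWstar; rewrite pq;
   split=> // w /h.
Qed.

Lemma proj_sup (A : set L) : LWstar_proj (sup A) = sup [set LWstar_proj p | p in A].
Proof. by apply: (congr1 sup); exact: (image_comp \val fst). Qed.

Lemma trace_sup (A : set L) w : trace (sup A) w <-> exists2 p, A p & trace p w.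
Proof.
split.
  by move=> /asboolP[_ [_ [p Ap <-] <-] pw]; exists p.
move=> [p Ap pw]; apply/asboolP; exists (\val p).2; last exact: pw.
by exists (\val p) => //; exists p.
Qed.

Lemma LWstar_proj_morph : frame_morphism (@LWstar_proj d E W).
Proof. by split=> // A; exact: proj_sup. Qed.

Lemma trace_join p q w : trace (p `|` q) w <-> trace p w \/ trace q w.
Proof.
rewrite -sup2 trace_sup; split=> [[_ [->|->] h]|[h|h]]; [by left|by right| |].
  by exists p => //; left.
by exists q => //; right.
Qed.

Lemma trace_meet p q w : trace (p `&` q) w <-> trace p w /\ trace q w.
Proof. by split=> [/andP[]|[pw qw]]; last exact/andP. Qed.

Lemma trace_bot w : ~ trace \bot w.
Proof. by rewrite -sup0 => /trace_sup[]. Qed.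

Lemma LWstar_joins_top p q : LWstar_proj p `|` LWstar_proj q = \top ->
  (forall w, trace p w \/ trace q w) -> p `|` q = \top.
Proof.
move=> pq h; apply: eq_LWstar.
  by rewrite (morph_join LWstar_proj_morph) pq.
by move=> w; split=> // _; apply/trace_join.
Qed.

Lemma prin_meet a b : prin (a `&` b) = prin a `&` prin b.
Proof.
apply: eq_LWstar => // w; rewrite trace_meet !trace_prin; split.
  by move=> h; split; apply: filter_up h _; [exact: leIl|exact: leIr].
by move=> [wa wb]; exact: filter_meet.
Qed.

Lemma prin_top : prin \top = \top.
Proof.
by apply: eq_LWstar => // w; split=> // _; apply/trace_prin; exact: filter_top.
Qed.

Lemma prin_bot : (forall w : W, proper_filter (\val w)) -> prin \bot = \bot.
Proof.
move=> WP; apply: eq_LWstar.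
  by rewrite (morph_bot LWstar_proj_morph).
by move=> w; split=> [/trace_prin /WP|/trace_bot].
Qed.

Lemma LW''_sup p : p = sup [set q : L | LW'' (\val q) /\ q <= p].
Proof.
have [A AL pA] := set_mem (valP p).
have LWsub x : LW'' x -> subframe_set L x.
  by move=> xL; exists [set x]; rewrite ?sup1 // => _ ->.
apply: le_anti; apply/andP; split; last by apply: sup_le => q [].
rewrite -Order.le_val {1}pA; apply: sup_le => x Ax; have xL := AL x Ax; apply: sup_ub.
exists (subframe_elt (LWsub x xL)) => //; split; first exact: xL.
by rewrite -Order.le_val pA; exact: sup_ub.
Qed.

End LWstarTheory.

(** * A base, complete regularity and density *)

Section Compactification.
Context {d : Order.disp_t} {E : frameType d}.
Hypotheses (Ereg : completely_regular E).
Local Notation W := (@max_round_filters d E).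
Local Notation L := (LWstar W).
Implicit Types (a b c : E) (s : seq E) (p q : L) (w : W).

Lemma maxW w : W (\val w).
Proof. exact: set_mem (valP w). Qed.

Lemma maxW_proper w : proper_filter (\val w).
Proof. by case: (maxW w). Qed.

Lemma maxW_round w : round_filter (\val w).
Proof. by case: (maxW w). Qed.

(** [prin (¬ a)] witnesses [prin a ≺ prin b]: it is disjoint from [prin a], and
by the dichotomy it covers together with [prin b]. *)
Lemma prin_completely_below a b : a ≺≺ b -> prin W a ≺≺ prin W b.
Proof.
apply: completely_below_map => {a b} a b ab.
apply: (@rather_belowI _ _ _ _ (prin W (¬ a))).
  by rewrite -prin_meet meet_psc prin_bot //; exact: maxW_proper.
apply: LWstar_joins_top; first exact: completely_below_rather.
move=> w; have [wb|wa] := max_dichotomy (maxW w) ab; [right|left]; exact/trace_prin.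
Qed.

(** Complete regularity of [E] gives the first component, roundness of the filters
the second. *)
Lemma prin_sup a : prin W a = sup [set prin W b | b in [set b | b ≺≺ a]].
Proof.
apply: eq_LWstar.
  rewrite proj_sup proj_prin [LHS]Ereg image_comp; congr sup.
  by apply/seteqP; split=> [b ba|_ [b ba <-]//]; exists b.
move=> w; rewrite trace_sup trace_prin; split.
  move=> /maxW_round[b wb ba]; exists (prin W b); last exact/trace_prin.
  by exists b.
move=> [_ [b ba <-] /trace_prin wb].
exact: filter_up wb (completely_below_le ba).
Qed.

Hypothesis Epl : pointless E.

(** Finite sets of filters are listed over [{classic W}], as sequences have a
membership predicate only over types with decidable equality. *)
Definition avoids (s : seq {classic W}) b : Prop :=
  forall w : {classic W}, w \in s -> ~ b ∈ \val (w : W).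

Lemma avoids_sup (s : seq {classic W}) : sup [set b | avoids s b] = \top.
Proof.
elim: s => [|w s IH].
  by apply/eqP; rewrite -le1x; apply: sup_ub.
apply/eqP; rewrite -le1x -[leLHS]meetx1 -{2}IH.
rewrite -(max_avoid_dense Ereg Epl (maxW w)) meet_sup2.
apply: sup_le => _ [b [c [/= wb sc ->]]]; apply: sup_ub => v.
rewrite inE => /orP[/eqP->|vs].
  apply: (filter_disjoint (@maxW_proper w) wb); rewrite meetC.
  exact: meet_le_bot (meet_psc b) (leIl _ _) (lexx _).
by move=> vbc; apply: (sc v vs); apply: filter_up vbc _; exact: leIr.
Qed.

Lemma avoids_mem (s : seq {classic W}) (w : {classic W}) :
  w \notin s -> exists2 b, b ∈ \val (w : W) & avoids s b.
Proof.
elim: s => [_|v s IH]; first by exists \top => //; exact: filter_top.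
rewrite inE negb_or => /andP[/eqP wv /IH[b wb sb]].
have wv' : \val (w : W) <> \val (v : W) by move=> /val_inj.
have [c wc vc] := max_separated (maxW w) (maxW v) wv'.
exists (c `&` b); first exact: filter_meet.
move=> u; rewrite inE => /orP[/eqP->|us] ucb.
  apply: (filter_disjoint (@maxW_proper v) vc _ (filter_up ucb (leIl _ _))).
  by rewrite meetC meet_psc.
by apply: (sb u us); apply: filter_up ucb _; exact: leIr.
Qed.

(** For a generator [(a, Z)] with exceptional filters [s], the elements
[b <= a] that avoid [s] have [W_b] inside [Z]; they join to [a] by [avoids_sup],
and every filter in [Z] contains one of them by [avoids_mem]. *)
Lemma prin_basis p : p = sup [set prin W b | b in [set b | prin W b <= p]].
Proof.
apply: le_anti; apply/andP; split; last by apply: sup_le => _ [b bp <-].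
rewrite {1}[p]LW''_sup; apply: sup_le => q [[a [Z [qE ZW Zfin]]] qp].
have [s sE] := proj1 (@finite_seqP {classic W} _) Zfin.
have aq : LWstar_proj q = a by rewrite /LWstar_proj qE.
have Zq w : Z w <-> trace q w.
  by rewrite /trace qE; split=> [/mem_set|/set_mem].
have sP (w : {classic W}) : w \in s <-> a ∈ \val (w : W) /\ ~ Z w.
  by have -> : (w \in s) = ([set` s] w) :> Prop by []; rewrite -sE.
pose D := [set b | avoids s b /\ b <= a].
have Dmeet b : avoids s b -> D (a `&` b).
  move=> sb; split; last exact: leIl.
  by move=> w ws wqb; apply: (sb w ws); apply: filter_up wqb _; exact: leIr.
have Dp b : D b -> prin W b <= p.
  move=> [sb bq]; apply: le_trans qp; apply/le_LWstar; rewrite aq.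
  split=> // w /trace_prin wb.
  apply/Zq; apply: contrapT => nZ; apply: (sb w) => //; apply/sP; split=> //.
  exact: filter_up wb bq.
apply: (@le_trans _ _ (sup [set prin W b | b in D])); last first.
  by apply: sup_sub => _ [b Db <-]; exists b => //; exact: Dp.
apply/le_LWstar; split.
  rewrite aq proj_sup -[leLHS]meetx1 -(avoids_sup s) meet_sup.
  apply: sup_le => _ [b sb <-]; apply: sup_ub.
  exists (prin W (a `&` b)) => //.
  by exists (a `&` b) => //; exact: Dmeet.
move=> w /Zq Zw; apply/trace_sup.
have ws : (w : {classic W}) \notin s by apply/negP => /sP[].
have [b wb sb] := avoids_mem ws.
exists (prin W (a `&` b)).
  by exists (a `&` b) => //; exact: Dmeet.
by apply/trace_prin; apply: filter_meet => //; exact: ZW.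
Qed.

Lemma LWstar_creg : completely_regular L.
Proof.
move=> p; apply: le_anti; apply/andP; split; last first.
  by apply: sup_le => q; exact: completely_below_le.
rewrite {1}[p]prin_basis; apply: sup_le => _ [b bp <-].
rewrite prin_sup; apply: sup_le => _ [c cb <-]; apply: sup_ub.
exact: completely_below_mono bp (prin_completely_below cb).
Qed.

Lemma LWstar_dense p : LWstar_proj p = \bot -> p = \bot.
Proof.
move=> p0; rewrite [p]prin_basis; apply/eqP; rewrite -lex0.
apply: sup_le => _ [b /le_LWstar[bp _] <-].
move: bp; rewrite p0 proj_prin lex0 => /eqP ->.
by rewrite prin_bot //; exact: maxW_proper.
Qed.

(** * Compactness *)

Section Compactness.
Variable A : set L.

Definition covered b : Prop := exists2 p, A p & prin W b <= p.
(** Passing to a completely smaller element leaves room for the filter of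
pseudocomplements below to be round. *)
Definition shrunk c : Prop := exists2 b, covered b & c ≺≺ b.

(** The roundness of the filter generated by the pseudocomplements of shrunk
elements: interpolate [c ≺≺ m ≺≺ b], and note that [¬ m ≺≺ ¬ c]. *)
Lemma shrunk_interp s : (forall c, c \in s -> shrunk c) -> exists t : seq E,
  (forall c, c \in t -> shrunk c) /\
  \meet_(c <- t) ¬ c ≺≺ \meet_(c <- s) ¬ c.
Proof.
elim: s => [_|c s IH cs].
  by exists [::]; split=> //; rewrite !big_nil; exact: completely_below_top.
have [b bA /completely_below_interp[m cm mb]] := cs c (mem_head c s).
have [|t [tP ts]] := IH; first by move=> x xs; apply: cs; rewrite inE xs orbT.
exists (m :: t); split.
  by move=> x; rewrite inE => /orP[/eqP->|/tP//]; exists b.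
by rewrite !big_cons; apply: completely_below_meet => //; exact: completely_below_psc.
Qed.

Lemma shrunk_finite s : (forall c, c \in s -> shrunk c) ->
  exists B : set L, [/\ B `<=` A, finite_set B &
    forall c, c \in s -> exists2 b, c ≺≺ b & prin W b <= sup B].
Proof.
elim: s => [_|c s IH cs]; first by exists set0; split.
have [b [p Ap bp] cb] := cs c (mem_head c s).
have [|B [BA Bfin sB]] := IH; first by move=> x xs; apply: cs; rewrite inE xs orbT.
exists (p |` B); split.
- by move=> q [->//|/BA].
- by rewrite finite_setU; split.
- move=> x; rewrite inE => /orP[/eqP->|/sB[e xe eB]].
    by exists b => //; apply: le_trans bp _; apply: sup_ub; left.
  by exists e => //; apply: le_trans eB _; apply: sup_sub => q; right.
Qed.

(** The properness of that filter, for a cover without finite subcover. Choose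
[c ≺≺ b] for each [c] in [s]. As [¬ c `|` b = \top], the join of the [b] is the
top; and a filter containing none of the [b] would contain every [¬ c], hence
bottom. *)
Lemma shrunk_cover s : (forall c, c \in s -> shrunk c) ->
  \meet_(c <- s) ¬ c = \bot -> exists B, [/\ B `<=` A, finite_set B & sup B = \top].
Proof.
move=> /shrunk_finite[B [BA Bfin sB]] s0; exists B; split=> //.
rewrite -[sup B]joinx0 joinC; apply: LWstar_joins_top.
  rewrite (morph_bot (LWstar_proj_morph W)) -s0.
  apply: join_meets_top => c /sB[b cb /le_LWstar[bB _]].
  exact: top_le_join (completely_below_rather cb) _ bB.
move=> w; right; apply: contrapT => nw; apply: (maxW_proper (w := w)).
rewrite -s0; apply: filter_meets => c /sB[b cb bB].
have [wb|//] := max_dichotomy (maxW w) cb.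
by case: nw; apply: trace_le bB _; exact/trace_prin.
Qed.

Lemma cover_finite : sup A = \top ->
  exists B, [/\ B `<=` A, finite_set B & sup B = \top].
Proof.
move=> AT; apply: contrapT => noB.
pose F := [set y | exists2 s, (forall c, c \in s -> shrunk c) &
  \meet_(c <- s) ¬ c <= y].
have Ftop : F \top by exists [::] => //; rewrite big_nil.
have Fup (x y : E) : F x -> x <= y -> F y.
  by move=> [s sA sx] xy; exists s => //; exact: le_trans xy.
have Fmeet (x y : E) : F x -> F y -> F (x `&` y).
  move=> [s sA sx] [t tA ty]; exists (s ++ t); last by rewrite big_cat leI2.
  by move=> c; rewrite mem_cat => /orP[/sA|/tA].
have [||w wW Fw] := @max_round_extend _ _ (FrameFilter Ftop Fup Fmeet).
- by move=> [s sA]; rewrite lex0 => /eqP /(shrunk_cover sA).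
- move=> y [s /shrunk_interp[t [tA ts]] sy].
  by exists (\meet_(c <- t) ¬ c); [exists t|exact: completely_below_mono sy ts].
have : trace \top (exist _ w (mem_set wW) : W) by [].
rewrite -AT => /trace_sup[p Ap]; rewrite [p]prin_basis => /trace_sup[_ [b bp <-]].
move=> /trace_prin /= wb.
have [wP wR _] := wW; have [c wc cb] := wR _ wb.
apply: (filter_disjoint wP wc (meet_psc c)); apply: Fw.
exists [:: c]; last by rewrite big_seq1.
by move=> x; rewrite inE => /eqP ->; exists b => //; exists p.
Qed.

End Compactness.

(** * Lifting morphisms from compact frames *)

Section Lifting.
Context {d' : Order.disp_t} {K : frameType d'}.
Variable f : K -> E.
Hypotheses (Kcpt : compact_frame K) (Kreg : completely_regular K).
Hypothesis f_mor : frame_morphism f.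
Implicit Types k l : K.

Definition lift k : L := sup [set prin W (f l) | l in [set l | l ≺≺ k]].

Lemma trace_lift k w : trace (lift k) w <-> exists2 l, l ≺≺ k & f l ∈ \val w.
Proof.
rewrite trace_sup; split=> [[_ [l lk <-] /trace_prin fl]|[l lk fl]].
  by exists l.
by exists (prin W (f l)); [exists l|exact/trace_prin].
Qed.

Lemma proj_lift k : LWstar_proj (lift k) = f k.
Proof.
by rewrite proj_sup image_comp [in RHS](Kreg k); case: f_mor => _ _ ->.
Qed.

(** Let [l ≺≺ sup C] and [f l] in [w]. The complement [¬ l] and the elements
completely below members of [C] cover [K]. If the conclusion failed, [w] would
contain [¬ f m] for each [m] of this cover, hence for each [m] of a finite
subcover; but those [f m] join to the top, so the meet of the [¬ f m] is bottom. *)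
Lemma trace_lift_sup (C : set K) w :
  trace (lift (sup C)) w -> exists2 k, C k & trace (lift k) w.
Proof.
move=> /trace_lift[l lC wl]; apply: contrapT => noC.
pose D := [set m | m = ¬ l \/ exists2 k, C k & m ≺≺ k].
have DT : sup D = \top.
  apply/eqP; rewrite -le1x -(completely_below_rather lC) leUx; apply/andP; split.
    by apply: sup_ub; left.
  apply: sup_le => k Ck; rewrite (Kreg k); apply: sup_sub => m mk.
  by right; exists k.
have Dw m : D m -> ¬ f m ∈ \val w.
  move=> [->|[k Ck mk]].
    apply: filter_up wl _; apply: le_psc; rewrite meetC.
    exact: (morph_disjoint f_mor (meet_psc l)).
  have [n mn nk] := completely_below_interp mk.
  have [wn|//] := max_dichotomy (maxW w) (morph_completely_below f_mor mn).
  by case: noC; exists k => //; apply/trace_lift; exists n.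
have [B [BD /finite_seqP[s sE] sT]] := Kcpt DT; subst B.
apply: (maxW_proper (w := w)).
suff <- : \meet_(m <- s) ¬ f m = \bot.
  by apply: filter_meets => m ms; apply: Dw; exact: BD.
case: (f_mor) => fT _ fS.
have fsT : sup [set f m | m in [set` s]] = \top by rewrite -fS sT.
rewrite -[LHS]meetx1 -[X in _ `&` X = _]fsT meet_sup.
apply/eqP; rewrite -lex0; apply: sup_le => _ [_ [m ms <-] <-].
rewrite -(meet_psc (f m)) meetC leI2 //.
exact: (meets_inf_seq (fun m => ¬ f m)).
Qed.

Lemma lift_mono k l : k <= l -> lift k <= lift l.
Proof.
move=> kl; apply: sup_sub => _ [m mk <-]; exists m => //.
exact: completely_below_mono kl mk.
Qed.

Lemma lift_morph : frame_morphism lift.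
Proof.
case: (f_mor) => fT fI fS; split=> [|k l|C].
- apply/eqP; rewrite -le1x; apply: sup_ub; exists \top; last by rewrite fT prin_top.
  exact: completely_below_top.
- apply: eq_LWstar; first by rewrite proj_lift fI -!proj_lift.
  move=> w; rewrite trace_meet; split.
    by move=> wkl; split; apply: trace_le wkl; apply: lift_mono;
      [exact: leIl|exact: leIr].
  move=> [/trace_lift[m mk wm] /trace_lift[n nl wn]]; apply/trace_lift.
  exists (m `&` n); first exact: completely_below_meet.
  by rewrite fI; exact: filter_meet.
- apply: le_anti; apply/andP; split; last first.
    by apply: sup_le => _ [k Ck <-]; apply: lift_mono; exact: sup_ub.
  apply/le_LWstar; split.
    rewrite proj_lift fS proj_sup image_comp; apply: sup_sub => _ [k Ck <-].
    by exists k => //; exact: proj_lift.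
  move=> w /trace_lift_sup[k Ck wk]; apply/trace_sup.
  by exists (lift k) => //; exists k.
Qed.

End Lifting.
End Compactification.

Theorem proposition8p1p5 (d : Order.disp_t) (E : frameType d)
    (E_creg : completely_regular E) (E_nonempty : nonempty_frame E)
    (E_pointless : pointless E) :
  compact_coreflection (@LWstar_proj d E (@max_round_filters d E)).
Proof.
split.
- by move=> A; exact: cover_finite.
- exact: LWstar_creg.
- exact: LWstar_proj_morph.
- move=> d' K Kcpt Kreg f f_mor; exists (lift f); split.
    by split; [exact: lift_morph|exact: proj_lift].
  move=> g [g_mor gf]; apply: (dense_monic Kreg (LWstar_proj_morph _)) => //.
  + exact: LWstar_dense.
  + exact: lift_morph.
  + by move=> k; rewrite gf proj_lift.
Qed.
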